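(* Let $p \geq 3$ be a prime number and $f(n) := \nu_p(P_n(p))$. Then for all integers $n\geq 0$ and $0\leq a < p$, \[ f(pn + a) = \begin{cases} f(n) + (n \bmod 2), & \text{if } a \text{ is even};\\ f(n) + 1 - (n \bmod 2), & \text{if } a \text{ is odd}. \end{cases} \]
   Context: $P_n(x)$ denotes the $n$-th Legendre polynomial, $P_n(x) = \sum_{k=0}^{n} \binom{n}{k}\binom{n+k}{k}\left(\frac{x-1}{2}\right)^k$. For a nonzero rational $r$, $\nu_p(r)$ is its $p$-adic valuation (exponent of $p$ in $r$). *)

(* Defs.v *)
From mathcomp Require Import all_boot all_order all_algebra.
Set Implicit Arguments.
Unset Strict Implicit.
Unset Printing Implicit Defensive.
Import Order.TTheory GRing.Theory Num.Theory.
Local Open Scope ring_scope.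

Definition legendre (n : nat) : {poly rat} :=
  \sum_(k < n.+1) ('C(n, k) * 'C(n + k, k))%:R *: (2^-1 *: ('X - 1)) ^+ k.

(* For a prime p and r != 0; the junk value at r = 0 is 0. *)
Definition padic_val (p : nat) (r : rat) : int :=
  (logn p `|numq r|)%:Z - (logn p `|denq r|)%:Z.

(* Main.v *)
(** The coefficient of [h^n] in [((x+h)^2 - 1)^n], computed by expanding around
    [x = 1] and around [x = 0], shows that
    [2^n P_n(x) = \sum_j (-1)^(n-j) C(n,j) C(2j,n) x^(2j-n)].
    At [x = p] the term of lowest degree strictly dominates [p]-adically: passing
    from it to the term of degree [2i] higher multiplies by an integer times
    [p^(2i) / (2i+e)!], where [e = n mod 2], and [v_p((2i+e)!) <= i] as [p >= 3].
    Hence [v_p(P_n(p)) = e + v_p(n!) - 2 v_p((n/2)!)], with [n/2] rounded down,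
    and the recursion follows from [v_p(N!) = N/p + v_p((N/p)!)]. *)
Require Import Defs.
From mathcomp Require Import all_boot all_order all_algebra.
From mathcomp Require Import zify ring.
Import Order.TTheory GRing.Theory Num.Theory.
Local Open Scope ring_scope.

Lemma coef_exprXDC (R : comNzRingType) (c : R) (m n : nat) :
  (('X + c%:P) ^+ m)`_n = c ^+ (m - n) *+ 'C(m, n).
Proof.
rewrite addrC exprDn coef_sum.
under eq_bigr => i _ do rewrite coefMn -polyC_exp coefCM coefXn.
have [le_nm|lt_mn] := leqP n m; last first.
  rewrite bin_small // mulr0n big1 // => i _.
  by rewrite (_ : (n == i :> nat) = false) ?mulr0 ?mul0rn //; have := ltn_ord i; lia.
rewrite (bigD1 (inord n)) //= inordK ?ltnS // eqxx mulr1 big1 ?addr0 // => i ne_in.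
rewrite (_ : (n == i :> nat) = false) ?mulr0 ?mul0rn //.
apply: contraNF ne_in => /eqP ->; by rewrite inord_val.
Qed.

Definition legendre_term (n j : nat) : nat := 'C(n, j) * 'C(j.*2, n).

(* Where [j.*2 - n] is truncated, the binomial [C(2j, n)] vanishes. *)
Definition legendre_num (n : nat) (x : int) : int :=
  \sum_(j < n.+1) (-1) ^+ (n - j) * (x ^+ (j.*2 - n) *+ legendre_term n j).

Lemma legendre_numE (n : nat) (x : int) :
  (legendre n).[x%:~R] = (legendre_num n x)%:~R / 2 ^+ n.
Proof.
apply: (canRL (mulfK _)); first by rewrite expf_neq0.
pose y : rat := x%:~R.
transitivity (((('X + y%:P) ^+ 2 - 1) ^+ n)`_n).
  pose z : rat := y - 1.
  have -> : ('X + y%:P) ^+ 2 - 1 = ('X + z%:P) * (('X + z%:P) + 2%:P) :> {poly rat}.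
    by rewrite /z polyCB; ring.
  (* Only the second factor is expanded: its term [k] raises the exponent of ['X + z%:P] to [n + k],
     and the coefficient of degree [n] there is [z ^+ k *+ 'C(n + k, n)]. *)
  rewrite exprMn [_ + 2%:P]addrC [(2%:P + _) ^+ n]exprDn mulr_sumr.
  rewrite coef_sum /legendre horner_sum mulr_suml.
  apply: eq_bigr => k _.
  rewrite mulrnAr coefMn mulrCA -exprD -polyC_exp coefCM coef_exprXDC.
  rewrite addKn !hornerE -/y -/z.
  have le_kn : (k <= n)%N by rewrite -ltnS.
  have -> : 2 ^+ n = 2 ^+ (n - k) * 2 ^+ k :> rat by rewrite -exprD subnK.
  have -> : 'C(n + k, n) = 'C(n + k, k) by rewrite -bin_sub ?leq_addr ?addKn.
  rewrite exprMn exprVn natrM.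
  rewrite -[_ * _ *+ _]mulr_natr -[_ ^+ _ *+ _]mulr_natr; field.
  by rewrite expf_neq0.
rewrite addrC exprDn coef_sum /legendre_num rmorph_sum /=.
apply: eq_bigr => j _.
rewrite coefMn -exprM -polyCN -polyC_exp coefCM coef_exprXDC mul2n.
rewrite /legendre_term rmorphM rmorphMn !rmorphXn /= rmorphN rmorph1 -/y.
rewrite -[_ * _ *+ _]mulr_natr -[_ ^+ _ *+ _]mulr_natr.
by rewrite -[_ ^+ _ *+ _]mulr_natr natrM; ring.
Qed.

(** Passing from N to N+1 changes either side only if p divides N+1, and then v_p(N+1) = 1 +
    v_p((N+1)/p). *)
Lemma logn_fact_div (p N : nat) : prime p ->
  logn p N`! = (N %/ p + logn p (N %/ p)`!)%N.
Proof.
move=> p_pr; have p_gt0 := prime_gt0 p_pr.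
elim: N => [|N IHN]; first by rewrite div0n.
rewrite factS lognM ?fact_gt0 // IHN divnS //.
have [dvd_pN|ndvd_pN] := boolP (p %| N.+1)%N; last first.
  by rewrite (lognE p N.+1) (negbTE ndvd_pN) !andbF !add0n.
have q_eq : (N.+1 %/ p = (N %/ p).+1)%N by rewrite divnS // dvd_pN.
rewrite add1n factS lognM ?fact_gt0 // -q_eq.
rewrite [in LHS](lognE p N.+1) p_pr /= dvd_pN q_eq; lia.
Qed.

(** With q = k/p rounded down, the recursion and induction give the bound 2q + (q-1) = 3q-1 <= pq-1
    <= k-1 when q > 0; for q = 0 the valuation vanishes. *)
Lemma logn_fact_le (p k : nat) : prime p -> (2 < p)%N ->
  ((logn p k`!).*2 <= k.-1)%N.
Proof.
move=> p_pr p_gt2; elim/ltn_ind: k => k IHk.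
have [k0|k_gt0] := posnP k; first by rewrite k0 logn1.
rewrite logn_fact_div //.
have := IHk _ (ltn_Pdiv (prime_gt1 p_pr) k_gt0).
have := leq_trunc_div k p; nia.
Qed.

(** The factor n! cancels between the two binomials. Writing n = 2m+e and j = m+e+i gives n-j = m-i
    and 2j-n = e+2i; when e is the parity of n, the lowest-degree term is i = 0. *)
Lemma legendre_term_fact (m e i : nat) : (i <= m)%N ->
  (legendre_term (m.*2 + e) (m + e + i) * (e + i.*2)`!
     * ((m - i)`! * (m + e + i)`!) = ((m + e + i).*2)`!)%N.
Proof.
move=> le_im; rewrite /legendre_term.
have F1 := @bin_fact (m.*2 + e) (m + e + i).
have F2 := @bin_fact (m + e + i).*2 (m.*2 + e).
rewrite -F2; last by lia.
rewrite -F1; last by lia.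
have -> : (m.*2 + e - (m + e + i) = m - i)%N by lia.
have -> : ((m + e + i).*2 - (m.*2 + e) = e + i.*2)%N by lia.
by ring.
Qed.

(** With j = m+e+i, the multiple is (2j)! / ((m-i)! j!), and raising i by one multiplies it by the
    integer 2(2j+1)(m-i). *)
Lemma dvdn_legendre_term (m e i : nat) : (e < 2)%N -> (i <= m)%N ->
  (legendre_term (m.*2 + e) (m + e)
    %| legendre_term (m.*2 + e) (m + e + i) * (e + i.*2)`!)%N.
Proof.
move=> lt_e2; elim: i => [_|i IHi lt_im].
  by rewrite addn0 dvdn_mulr.
apply: dvdn_trans (IHi (ltnW lt_im)) _.
have Fi := legendre_term_fact m e i (ltnW lt_im).
have FSi := legendre_term_fact m e i.+1 lt_im.
set D := (legendre_term _ (m + e + i) * _)%N in Fi *.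
set D' := (legendre_term _ _ * _)%N in FSi *.
suff -> : (D' = D * (2 * (m + e + i).*2.+1 * (m - i)))%N by rewrite dvdn_mulr.
apply/eqP; rewrite -(@eqn_pmul2r ((m - i.+1)`! * (m + e + i.+1)`!)); last first.
  by rewrite muln_gt0 !fact_gt0.
rewrite FSi addnS doubleS !factS -Fi -[in X in X == _](subnSK lt_im) factS.
by apply/eqP; rewrite (subnSK lt_im) -!muln2; ring.
Qed.

Lemma logn_legendre_term (p n : nat) : prime p -> (2 < p)%N ->
  (logn p (legendre_term n (uphalf n)) + (logn p (n./2)`!).*2 = logn p n`!)%N.
Proof.
move=> p_pr p_gt2.
have en : n = (n./2.*2 + odd n)%N by rewrite addnC odd_double_half.
have := legendre_term_fact n./2 (odd n) 0 isT.
rewrite -en uphalf_half addn0 subn0 addn0 [(n./2 + odd n)%N]addnC.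
set U := legendre_term _ _ => F.
(* The power of 2 comes from odd n = 2m+1, where (n+1)!/(m+1)! is n!/m! times (n+1)/(m+1) = 2. *)
have E : (U * (n./2`! * n./2`!) = 2 ^ odd n * n`!)%N.
  case: (odd n) en F => /= en F.
    apply/eqP; rewrite -(@eqn_pmul2r (n./2).+1) //; apply/eqP.
    have -> : (2 ^ 1 * n`! * n./2.+1 = (1 + n./2).*2`!)%N.
      have e1 : n./2.*2.+1 = n by lia.
      have e2 : n.+1 = (2 * n./2.+1)%N by lia.
      by rewrite add1n doubleS factS e1 e2; ring.
    by rewrite -F add1n (factS n./2) (_ : 1`! = 1%N) //; ring.
  have e0 : (0 + n./2).*2 = n by lia.
  by rewrite e0 muln1 in F; rewrite mul1n -F.
have U_gt0 : (0 < U)%N.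
  have := fact_gt0 n; have := expn_gt0 2 (odd n).
  by case: (posnP U) E => // ->; rewrite mul0n; nia.
have := congr1 (logn p) E.
clearbody U; rewrite !lognM ?muln_gt0 ?fact_gt0 ?expn_gt0 // lognX.
rewrite (@logn_prime p 2) // gtn_eqF //; lia.
Qed.

Lemma padic_val_frac (p : nat) (a b : int) : a != 0 -> b != 0 ->
  padic_val p (a%:~R / b%:~R) = (logn p `|a|)%:Z - (logn p `|b|)%:Z.
Proof.
move=> a0 b0; rewrite /padic_val; set r := _ / _.
have E : numq r * b = a * denq r.
  by apply: (@intr_inj rat); rewrite !rmorphM /= numqE /r mulrAC divfK ?intr_eq0.
have num0 : numq r != 0.
  by rewrite numq_eq0 mulf_neq0 ?invr_eq0 ?intr_eq0.
have := congr1 (fun z : int => logn p `|z|) E.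
rewrite !abszM !lognM ?absz_gt0 ?denq_neq0 //; lia.
Qed.

(** The strict case of the ultrametric inequality: with v the valuation of x, if p^(v+1) divided
    x+y, it would divide x. This also rules out a zero sum. *)
Lemma logn_abszD (p : nat) (x y : int) : prime p -> x != 0 ->
  (p ^ (logn p `|x|).+1 %| `|y|)%N ->
  x + y != 0 /\ logn p `|x + y| = logn p `|x|.
Proof.
move=> p_pr x0; set v := logn p `|x| => dvd_y.
have dvd_absz k z : (p ^ k %| `|z|)%N = ((p ^ k)%N %| z)%Z by rewrite dvdzE.
have ndvd : ~~ (p ^ v.+1 %| `|(x + y)%R|)%N.
  apply/negP => dvd_xy.
  have : (p ^ v.+1 %| `|x|)%N.
    rewrite dvd_absz -(addrK y x); apply: rpredB; first by rewrite -dvd_absz.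
    by rewrite -dvd_absz.
  by rewrite pfactor_dvdn ?absz_gt0 // ltnn.
have xy0 : x + y != 0 by apply: contraNneq ndvd => ->; rewrite dvdn0.
split=> //; apply/eqP; rewrite eqn_leq.
rewrite pfactor_dvdn ?absz_gt0 // -leqNgt in ndvd; rewrite ndvd /=.
rewrite -pfactor_dvdn ?absz_gt0 // dvd_absz; apply: rpredD; rewrite -dvd_absz.
  by rewrite pfactor_dvdn ?absz_gt0.
by apply: dvdn_trans dvd_y; rewrite dvdn_exp2l.
Qed.

Lemma logn_legendre_num (p n : nat) : prime p -> (2 < p)%N ->
  legendre_num n p != 0 /\
  logn p `|legendre_num n p| = (odd n + logn p (legendre_term n (uphalf n)))%N.
Proof.
move=> p_pr p_gt2; have p_gt0 := prime_gt0 p_pr.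
have abs_term j :
    absz ((-1) ^+ (n - j) * (p%:Z ^+ (j.*2 - n) *+ legendre_term n j)) =
      (p ^ (j.*2 - n) * legendre_term n j)%N.
  by rewrite abszMsign -mulr_natr abszM abszX !absz_nat natz absz_nat.
have up_n : (uphalf n).*2 = (odd n + n)%N.
  by rewrite uphalf_half; have := odd_double_half n; lia.
have lt_up : (uphalf n < n.+1)%N by case: (odd n) up_n; lia.
have L0 : (0 < legendre_term n (uphalf n))%N.
  by rewrite muln_gt0 !bin_gt0 up_n; lia.
rewrite /legendre_num (bigD1 (Ordinal lt_up)) //=.
set x := (X in X + _); set y := (X in _ + X).
have abs_x : `|x|%N = (p ^ odd n * legendre_term n (uphalf n))%N.
  by rewrite /x abs_term up_n addnK.
have log_x : logn p `|x| = (odd n + logn p (legendre_term n (uphalf n)))%N.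
  by rewrite abs_x lognM ?expn_gt0 ?p_gt0 // pfactorK.
rewrite -log_x; apply: logn_abszD => //.
  by rewrite -absz_gt0 abs_x muln_gt0 expn_gt0 p_gt0.
rewrite log_x -[(p ^ _)%N]absz_nat -dvdzE; apply: rpred_sum => -[j lt_jn] /= ne_j.
rewrite dvdzE abs_term absz_nat.
(* Vanishing terms, among them all those with 2j < n, are divisible by anything; the others have
   [j = uphalf n + i] with [i > 0]. *)
have [Lj0|Lj] := posnP (legendre_term n j); first by rewrite Lj0 muln0 dvdn0.
have le_nj : (n <= j.*2)%N.
  by rewrite leqNgt; apply/negP => lt; rewrite /legendre_term (bin_small lt) muln0 in Lj.
have {}ne_j : j != uphalf n by [].
have en : (n./2.*2 + odd n)%N = n by rewrite addnC odd_double_half.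
have um : (n./2 + odd n)%N = uphalf n by rewrite addnC uphalf_half.
have [i ji] : exists i, j = (n./2 + odd n + i)%N by exists (j - uphalf n)%N; lia.
have i_gt0 : (0 < i)%N by lia.
have le_im : (i <= n./2)%N by lia.
have := dvdn_legendre_term n./2 (odd n) i (leq_b1 (odd n)) le_im.
rewrite en -ji um => dvdL.
have : (logn p (legendre_term n (uphalf n)) <=
        logn p (legendre_term n j) + logn p (odd n + i.*2)`!)%N.
  rewrite -lognM ?fact_gt0 //; apply: dvdn_leq_log dvdL.
  by rewrite muln_gt0 Lj fact_gt0.
(* With e = [odd n], 2 v_p((e+2i)!) <= e+2i-1 <= 2i, so the coefficient loses at most i, while the
   power of p gains 2i >= i+1. *)
have := logn_fact_le p (odd n + i.*2) p_pr p_gt2.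
have pX_gt0 k : (0 < p ^ k)%N by rewrite expn_gt0 p_gt0.
rewrite pfactor_dvdn //; last exact: (leq_mul (pX_gt0 _) Lj).
rewrite (lognM _ (pX_gt0 _) Lj).
rewrite pfactorK //; have := leq_b1 (odd n); lia.
Qed.

Lemma padic_val_legendre (p n : nat) : prime p -> (2 < p)%N ->
  padic_val p (legendre n).[p%:R] =
    (odd n)%:Z + (logn p n`!)%:Z - (logn p (n./2)`!).*2%:Z.
Proof.
move=> p_pr p_gt2; have [num0 log_num] := logn_legendre_num p n p_pr p_gt2.
rewrite -[p%:R]/(p%:Z%:~R) legendre_numE.
have -> : 2 ^+ n = (2 ^+ n : int)%:~R :> rat by rewrite rmorphXn.
rewrite padic_val_frac ?expf_neq0 // log_num abszX lognX.
(* As p is odd, the denominator [2 ^+ n] has valuation 0. *)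
rewrite (@logn_prime p 2) // gtn_eqF // muln0.
by have := logn_legendre_term p n p_pr p_gt2; lia.
Qed.

Theorem theorem6 (p : nat) (hp : prime p) (hp3 : (3 <= p)%N) :
  let f := fun n : nat => padic_val p (legendre n).[p%:R] in
  forall n a : nat, (a < p)%N ->
    f (p * n + a)%N =
      if odd a then f n + 1 - (n %% 2)%N%:Z else f n + (n %% 2)%N%:Z.
Proof.
move=> f n a lt_ap; rewrite /f !padic_val_legendre //.
have p_gt0 := prime_gt0 hp.
have odd_p : odd p by case: (even_prime hp) hp3 => [->|].
rewrite (@logn_fact_div p (p * n + a)) // (@logn_fact_div p (p * n + a)./2) //.
(* Halving and dividing by p commute under rounding down, and [a < p] disappears in the division by
   p. *)
have -> : ((p * n + a)./2 %/ p = n./2)%N.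
  rewrite -divn2 -divnMA [(2 * p)%N]mulnC divnMA [(p * n)%N]mulnC divnMDl //.
  by rewrite (divn_small lt_ap) addn0 divn2.
rewrite [(p * n)%N]mulnC divnMDl // (divn_small lt_ap) addn0.
(* Since n - 2(n/2) is [odd n], the increment f(pn+a) - f(n) is just the parity of pn+a, which is
   that of n+a because p is odd. *)
rewrite oddD oddM odd_p andbT modn2.
have := odd_double_half n.
by case: (odd a); case: (odd n) => /=; lia.
Qed.
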